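(* Let $H$ be a simple hypergraph on $n$ vertices with $e$-index $k$, having at least one edge of cardinality two. Let $G$ be the spanning induced subgraph of $H$. Then $$\chi_s(H)\geq\chi(H)\geq \chi(G)\geq 1+\frac{\lambda_1(G)}{|\lambda_n(G)|}\geq 1+\frac{\lambda_1(G)}{|\lambda_{k}(H)|},$$ where $\lambda_1(G)$ and $\lambda_n(G)$ are the largest and smallest eigenvalues of the adjacency matrix of $G$, and $\lambda_k(H)$ is the smallest eigenvalue of the unified matrix $\mathbf{U}(H)$.
   Context: A hypergraph $H$ consists of a finite non-empty vertex set $V(H)$ and a multiset $E(H)$ of non-empty subsets of $V(H)$, called edges. It is simple if it has no loops (edges of cardinality one) and no multiple edges. A 2-partition of a set $e$ is an unordered pair $\{S,S'\}$ of non-empty disjoint sets with $S\cup S'=e$; $S$ and $S'$ are called parts of $e$. $I(H)$ is the set of all parts of all edges of $H$ together with all singleton subsets of $V(H)$, and $k=|I(H)|$ is the $e$-index of $H$. For simple $H$, the unified matrix $\mathbf{U}(H)$ is the $k\times k$ matrix indexed by $I(H)$ whose $(S,S')$ entry is $1$ if $\{S,S'\}$ is a 2-partition of an edge of $H$, and $0$ otherwise. The spanning induced subgraph $G$ of $H$ is the graph with vertex set $V(G)=V(H)$ whose edges are all the edges of $H$ of cardinality two. A proper (weak) coloring of a loopless hypergraph is an assignment of colors to its vertices such that in every edge at least two vertices receive different colors; $\chi(H)$ is the minimum number of colors in such a coloring ($\chi(G)$ is the usual chromatic number for a graph $G$). A strong coloring is a coloring of the vertices such that in every edge all vertices receive different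 colors; $\chi_s(H)$ is the minimum number of colors in a strong coloring. *)

(* Defs.v *)
From HB Require Import structures.
From mathcomp Require Import all_boot all_order all_algebra.
From mathcomp Require Import all_classical all_reals.
(* so that set0 and [disjoint _ & _] refer to finite sets *)
From mathcomp Require Import fintype finset.

Set Implicit Arguments.
Unset Strict Implicit.
Unset Printing Implicit Defensive.

Import Order.TTheory GRing.Theory Num.Theory.

Local Open Scope ring_scope.

(* The multiset of edges is given by its multiplicity function on subsets. *)
Record hypergraph (V : finType) := Hypergraph {
  edge_mult : {ffun {set V} -> nat};
  vertex_nonempty : (0 < #|V|)%N;
  edge_nonempty : edge_mult set0 = 0%N
}.

Section Hypergraph.
Variables (V : finType) (H : hypergraph V).

Definition edges : {set {set V}} := [set e : {set V} | (0 < edge_mult H e)%N].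

Definition loopless : Prop := forall e, e \in edges -> #|e| != 1%N.

Definition simple : Prop := loopless /\ (forall e, (edge_mult H e <= 1)%N).

Definition two_partition (e S S' : {set V}) : bool :=
  [&& S != set0, S' != set0, [disjoint S & S'] & S :|: S' == e].

Definition part (e S : {set V}) : bool := [exists S', two_partition e S S'].

Definition part_index : {set {set V}} :=
  [set S : {set V} | [exists e in edges, part e S]]
  :|: [set [set v] | v : V].

Definition e_index : nat := #|part_index|.

Definition unified_matrix (R : realType) : 'M[R]_e_index :=
  \matrix_(i, j)
    ([exists e in edges, two_partition e (enum_val i) (enum_val j)] : nat)%:R.

(* Used only for graphs, i.e. when all edges have cardinality two. *)
Definition adjacency_matrix (R : realType) : 'M[R]_#|V| :=
  \matrix_(i, j) (([set enum_val i; enum_val j] \in edges) : nat)%:R.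

Definition proper_coloring (C : finType) (f : {ffun V -> C}) : bool :=
  [forall e in edges, [exists u in e, exists v in e, f u != f v]].

Definition strong_coloring (C : finType) (f : {ffun V -> C}) : bool :=
  [forall e in edges, forall u in e, forall v in e, (u != v) ==> (f u != f v)].

(* An injective coloring is strong, and is proper when H is loopless, so #|V|
   colors suffice and the minimum may be taken over 0 <= c <= #|V|.  If H has a
   loop there is no proper coloring and the value is meaningless. *)
Definition chromatic_number : nat :=
  [arg min_(c < (ord_max : 'I_#|V|.+1)
      | [exists f : {ffun V -> 'I_c}, proper_coloring f]) (c : nat)].

Definition strong_chromatic_number : nat :=
  [arg min_(c < (ord_max : 'I_#|V|.+1)
      | [exists f : {ffun V -> 'I_c}, strong_coloring f]) (c : nat)].

Definition spanning_mult : {ffun {set V} -> nat} :=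
  [ffun e : {set V} => if #|e| == 2%N then edge_mult H e else 0%N].

Lemma spanning_mult0 : spanning_mult set0 = 0%N.
Proof. by rewrite ffunE cards0. Qed.

Definition spanning_subgraph : hypergraph V :=
  Hypergraph (vertex_nonempty H) spanning_mult0.

End Hypergraph.

(* Both values are the intended ones for a symmetric matrix of positive size;
   they default to 0 when the matrix has no eigenvalue in R. *)
Definition largest_eigenvalue (R : realType) (n : nat) (A : 'M[R]_n) : R :=
  xget 0 [set a | eigenvalue A a /\ forall b, eigenvalue A b -> b <= a]%classic.

Definition smallest_eigenvalue (R : realType) (n : nat) (A : 'M[R]_n) : R :=
  xget 0 [set a | eigenvalue A a /\ forall b, eigenvalue A b -> a <= b]%classic.

(* Main.v *)
Require Import Defs.
From HB Require Import structures.
From mathcomp Require Import all_boot all_order all_algebra.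
From mathcomp Require Import all_classical all_reals.
From mathcomp Require Import fintype finset ring lra.

(** The two comparisons of chromatic numbers come from inclusions of sets of
    colorings: every edge of a simple hypergraph has two distinct vertices, so a
    strong coloring is proper, and a proper coloring of [H] is proper for [G],
    whose edges are among those of [H].

    The spectral inequalities rest on the variational description of the extreme
    eigenvalues of a real symmetric matrix [A]: the smallest one is an eigenvalue
    and bounds the quadratic form of [A] from below ([smallest_eigenvalueP]), and
    symmetrically for the largest one ([largest_eigenvalueP]).  The least
    eigenvalue is found as the supremum of the [t] for which [A - t] is positive
    semidefinite: at the supremum [A - t] is singular, because an invertible
    positive semidefinite matrix dominates a positive multiple of the identity
    ([psd_unit_coercive]), which would leave room for a larger [t].

    Hoffman's bound ([Hoffman_bound]) needs no more than this.  Take an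
    eigenvector [x] for the largest eigenvalue [l], split it along the [c] color
    classes as the sum of the [x_j], and add up the lower bounds of the quadratic
    form at the vectors [x - c x_j].  Since each color class is independent, the
    form vanishes on each [x_j], the sum is [- c l |x|^2], and the squared norms
    add up to [c (c - 1) |x|^2].  Hence [l + (c - 1) m <= 0], where [m] is the
    least eigenvalue.  One edge makes [m] at most [-1] and [l] at least [1]
    ([extreme_eigenvalues_entry]), so that dividing by [|m|] is legitimate.

    Finally, the adjacency matrix of [G] is the principal submatrix of the
    unified matrix of [H] on the singletons ([unified_matrix_singletons]), and
    the least eigenvalue can only grow in a principal submatrix
    ([smallest_eigenvalue_mxsub]).  So both least eigenvalues are negative and the
    one of [H] has the larger absolute value. *)

Set Implicit Arguments.
Unset Strict Implicit.
Unset Printing Implicit Defensive.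

Import Order.TTheory GRing.Theory Num.Theory.
Local Open Scope ring_scope.

(** * The dot product of row vectors *)

Section Dot.
Context {R : realType}.

Definition dot {n} (x y : 'rV[R]_n) : R := (x *m y^T) 0 0.

Lemma dotE n (x y : 'rV[R]_n) : dot x y = \sum_i x 0 i * y 0 i.
Proof. by rewrite /dot mxE; apply: eq_bigr => i _; rewrite mxE. Qed.

Lemma dotC n (x y : 'rV[R]_n) : dot x y = dot y x.
Proof. by rewrite !dotE; apply: eq_bigr => i _; rewrite mulrC. Qed.

Lemma dotDl n (x y z : 'rV[R]_n) : dot (x + y) z = dot x z + dot y z.
Proof. by rewrite /dot mulmxDl mxE. Qed.

Lemma dotZl n a (x z : 'rV[R]_n) : dot (a *: x) z = a * dot x z.
Proof. by rewrite /dot -scalemxAl mxE. Qed.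

Lemma dotNl n (x z : 'rV[R]_n) : dot (- x) z = - dot x z.
Proof. by rewrite -scaleN1r dotZl mulN1r. Qed.

Lemma dotDr n (x y z : 'rV[R]_n) : dot z (x + y) = dot z x + dot z y.
Proof. by rewrite dotC dotDl !(dotC z). Qed.

Lemma dotZr n a (x z : 'rV[R]_n) : dot z (a *: x) = a * dot z x.
Proof. by rewrite dotC dotZl (dotC z). Qed.

Lemma dotNr n (x z : 'rV[R]_n) : dot z (- x) = - dot z x.
Proof. by rewrite dotC dotNl (dotC z). Qed.

Lemma dot_sumr n (I : finType) (z : 'rV[R]_n) (y : I -> 'rV[R]_n) :
  dot z (\sum_i y i) = \sum_i dot z (y i).
Proof. by rewrite /dot linear_sum mulmx_sumr summxE. Qed.

Lemma dot_ge0 n (x : 'rV[R]_n) : 0 <= dot x x.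
Proof. by rewrite dotE sumr_ge0 // => i _; rewrite -expr2 sqr_ge0. Qed.

Lemma dot_eq0 n (x : 'rV[R]_n) : (dot x x == 0) = (x == 0).
Proof.
apply/eqP/eqP => [|->]; last by rewrite /dot mul0mx mxE.
rewrite dotE => /eqP; rewrite psumr_eq0 => [/allP x0|i _]; last first.
  by rewrite -expr2 sqr_ge0.
apply/rowP => i; rewrite mxE; apply/eqP.
by have := x0 i (mem_index_enum i); rewrite -expr2 sqrf_eq0.
Qed.

Lemma dot_gt0 n (x : 'rV[R]_n) : (0 < dot x x) = (x != 0).
Proof. by rewrite lt_def dot_ge0 andbT dot_eq0. Qed.

Lemma dot_mulmx m n (x : 'rV[R]_m) (A : 'M_(m, n)) (y : 'rV_n) :
  dot (x *m A) y = dot x (y *m A^T).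
Proof. by rewrite /dot trmx_mul trmxK mulmxA. Qed.

Lemma dot_mulmxC n (A : 'M[R]_n) (x y : 'rV_n) : A^T = A ->
  dot (x *m A) y = dot (y *m A) x.
Proof. by move=> symA; rewrite dot_mulmx symA dotC. Qed.

Lemma dot_mulmx_le n (A : 'M[R]_n) :
  exists2 M, 0 < M & forall x, dot (x *m A) x <= M * dot x x.
Proof.
exists (1 + \sum_j \sum_i `|A i j|) => [|x].
  apply: (lt_le_trans ltr01); rewrite lerDl.
  by do 2![apply: sumr_ge0 => ? _].
have sq_le i : x 0 i ^+ 2 <= dot x x.
  rewrite dotE (bigD1 i) //= -expr2 lerDl.
  by apply: sumr_ge0 => j _; rewrite -expr2 sqr_ge0.
apply: (@le_trans _ _ ((\sum_j \sum_i `|A i j|) * dot x x)); last first.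
  by rewrite ler_wpM2r ?dot_ge0 // lerDr.
rewrite dotE mulr_suml; apply: ler_sum => j _.
rewrite mxE !mulr_suml; apply: ler_sum => i _.
rewrite mulrC mulrA mulrC; apply: le_trans (ler_norm _) _.
rewrite normrM ler_wpM2l // ler_norml.
have := sq_le i; have := sq_le j.
by have := sqr_ge0 (x 0 i - x 0 j); have := sqr_ge0 (x 0 i + x 0 j); nra.
Qed.

End Dot.

(** * Extreme eigenvalues of symmetric matrices *)

Section Rayleigh.
Context {R : realType}.

(** With [M] bounding the quadratic form [q] of [B] from above, positivity at
    [x - M^-1 (x B)] gives [|x B|^2 <= M q(x)]; and [x] is recovered from [x B] by
    the inverse matrix, which is bounded too. *)
Lemma psd_unit_coercive {n} {B : 'M[R]_n} : B^T = B -> B \in unitmx ->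
    (forall x, 0 <= dot (x *m B) x) ->
  exists2 e, 0 < e & forall x, e * dot x x <= dot (x *m B) x.
Proof.
move=> symB unitB psdB.
have [M M0 leM] := dot_mulmx_le B.
have [K K0 leK] := dot_mulmx_le (invmx B *m (invmx B)^T).
exists (K * M)^-1 => [|x]; first by rewrite invr_gt0 mulr_gt0.
have image_le : dot (x *m B) (x *m B) <= M * dot (x *m B) x.
  have := psdB (x - M^-1 *: (x *m B)).
  rewrite mulmxBl -scalemxAl !(dotDl, dotDr, dotNl, dotNr, dotZl, dotZr).
  rewrite (dot_mulmxC (x *m B) x symB).
  set q := dot (x *m B) x; set s := dot (x *m B) (x *m B).
  set t := dot _ (x *m B); have tM : t <= M * s by apply: leM.
  (* Multiplying by [M^2] clears the denominators; [t <= M s] then leaves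
     [M s <= M^2 q]. *)
  move=> h; have : 0 <= M ^+ 2 * q - 2 * M * s + t.
    have -> : M ^+ 2 * q - 2 * M * s + t = M ^+ 2 *
      (q - M^-1 * s + (- (M^-1 * s) - - (M^-1 * (M^-1 * t)))).
      by field; rewrite gt_eqF.
    by rewrite mulr_ge0 // sqr_ge0.
  by move=> h2; rewrite -(ler_pM2l M0); nra.
have vec_le : dot x x <= K * dot (x *m B) (x *m B).
  have := leK (x *m B); rewrite mulmxA mulmxK // dot_mulmx trmxK.
  by rewrite mulmxK.
rewrite ler_pdivrMl ?mulr_gt0 //; apply: le_trans vec_le _.
by rewrite -mulrA ler_pM2l.
Qed.

Lemma eigenvalue_le_Rayleigh {n} {A : 'M[R]_n} {m a} :
    (forall x, m * dot x x <= dot (x *m A) x) -> eigenvalue A a -> m <= a.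
Proof.
move=> lem /eigenvalueP[x xA x0]; have := lem x.
by rewrite xA dotZl ler_pM2r // dot_gt0.
Qed.

(** The bound [m] is the supremum of all the [t] with [A - t] positive
    semidefinite.  If [A - m] were invertible, it would be coercive, and [m]
    could be increased. *)
Lemma min_Rayleigh {n} (A : 'M[R]_n) : (0 < n)%N -> A^T = A ->
  exists2 m, eigenvalue A m & forall x, m * dot x x <= dot (x *m A) x.
Proof.
move=> n0 symA.
pose E := [set t | forall x : 'rV_n, t * dot x x <= dot (x *m A) x]%classic.
have E_ub x : x != 0 -> ubound E (dot (x *m A) x / dot x x).
  by move=> x0 t Et; rewrite ler_pdivlMr ?dot_gt0 // Et.
have E_neq0 : (E !=set0)%classic.
  have [M M0 leM] := dot_mulmx_le (- A).
  by exists (- M) => x; have := leM x; rewrite mulmxN dotNl mulNr; lra.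
have supE : has_sup E.
  pose e0 : 'rV[R]_n := delta_mx 0 (Ordinal n0).
  split=> //; exists (dot (e0 *m A) e0 / dot e0 e0); apply: E_ub.
  apply/eqP => /matrixP/(_ 0 (Ordinal n0)).
  by rewrite !mxE !eqxx => /eqP; rewrite oner_eq0.
have supP : E (sup E).
  move=> x; have [->|x0] := eqVneq x 0.
    by rewrite mul0mx /dot mul0mx mxE mulr0.
  by rewrite -ler_pdivlMr ?dot_gt0 //; apply: ge_sup => //; apply: E_ub.
exists (sup E) => //; apply: contraT.
rewrite /eigenvalue /eigenspace negbK kermx_eq0 row_free_unit => unitB.
have shiftE x : dot (x *m (A - (sup E)%:M)) x
    = dot (x *m A) x - sup E * dot x x.
  by rewrite mulmxBr mul_mx_scalar dotDl dotNl dotZl.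
have [|x|e e0 lee] := psd_unit_coercive _ unitB.
- by rewrite linearB /= symA tr_scalar_mx.
- by rewrite shiftE subr_ge0; apply: supP.
suff /(sup_upper_bound supE) : E (sup E + e) by rewrite gerDl leNgt e0.
by move=> x; have := lee x; rewrite shiftE; lra.
Qed.

Lemma smallest_eigenvalueP {n} {A : 'M[R]_n} : (0 < n)%N -> A^T = A ->
  eigenvalue A (smallest_eigenvalue A) /\
  forall x, smallest_eigenvalue A * dot x x <= dot (x *m A) x.
Proof.
move=> n0 symA; have [m eigm lem] := min_Rayleigh n0 symA.
have [|eigs les] := xgetPex 0 (P := [set a | eigenvalue A a /\
    forall b, eigenvalue A b -> a <= b]%classic).
  by exists m; split=> // b; apply: eigenvalue_le_Rayleigh.
split=> // x; apply: le_trans (lem x).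
by rewrite ler_wpM2r ?dot_ge0 // les.
Qed.

Lemma eigenvalueN n (A : 'M[R]_n) a : eigenvalue (- A) a = eigenvalue A (- a).
Proof.
apply/eigenvalueP/eigenvalueP => -[x xA x0]; exists x => //; move: xA.
  by rewrite mulmxN scaleNr => <-; rewrite opprK.
by rewrite mulmxN scaleNr => ->; rewrite opprK.
Qed.

Lemma largest_eigenvalueP {n} {A : 'M[R]_n} : (0 < n)%N -> A^T = A ->
  eigenvalue A (largest_eigenvalue A) /\
  forall x, dot (x *m A) x <= largest_eigenvalue A * dot x x.
Proof.
move=> n0 symA.
have [|m eigm lem] := @min_Rayleigh n (- A) n0; first by rewrite linearN /= symA.
have [|eigs les] := xgetPex 0 (P := [set a | eigenvalue A a /\
    forall b, eigenvalue A b -> b <= a]%classic).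
  exists (- m); split=> [|b eigb]; first by rewrite -eigenvalueN.
  rewrite lerNr; apply: (eigenvalue_le_Rayleigh lem).
  by rewrite eigenvalueN opprK.
split=> // x; apply: (@le_trans _ _ (- m * dot x x)).
  by have := lem x; rewrite mulmxN dotNl; lra.
by rewrite ler_wpM2r ?dot_ge0 // les // -eigenvalueN.
Qed.

(** Extending a vector by zero along [f] preserves its norm and turns the
    quadratic form of the submatrix into that of [B]; this extension is right
    multiplication by [P]. *)
Lemma smallest_eigenvalue_mxsub {n k} {f : 'I_n -> 'I_k} {B : 'M[R]_k} :
    (0 < n)%N -> (0 < k)%N -> injective f -> B^T = B ->
  smallest_eigenvalue B <= smallest_eigenvalue (mxsub f f B).
Proof.
move=> n0 k0 injf symB.
have symA : (mxsub f f B)^T = mxsub f f B by rewrite trmx_mxsub symB.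
have [eigA _] := smallest_eigenvalueP n0 symA.
have [_ leB] := smallest_eigenvalueP k0 symB.
pose P : 'M[R]_(n, k) := rowsub f 1%:M.
have PE (C : 'M[R]_k) : P *m C *m P^T = mxsub f f C.
  rewrite -rowsubE trmx_mxsub trmx1 mulmx_colsub mulmx1.
  by apply/matrixP => i j; rewrite !mxE.
have restr (C : 'M[R]_k) x :
    dot (x *m P *m C) (x *m P) = dot (x *m mxsub f f C) x.
  by rewrite /dot trmx_mul -PE !mulmxA.
apply: eigenvalue_le_Rayleigh eigA => x; have := leB (x *m P).
rewrite restr -{1}(mulmx1 (x *m P)) restr.
suff -> : mxsub f f 1%:M = 1%:M :> 'M[R]_n by rewrite mulmx1.
by apply/matrixP => i j; rewrite !mxE (inj_eq injf).
Qed.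

Lemma dot_delta_mulmx {n} (A : 'M[R]_n) i j :
  dot (delta_mx 0 i *m A) (delta_mx 0 j) = A i j.
Proof. by rewrite /dot trmx_delta -rowE -colE !mxE. Qed.

(** The quadratic form is evaluated at the difference and at the sum of two
    vectors of the standard basis. *)
Lemma extreme_eigenvalues_entry {n} {A : 'M[R]_n} {i j} :
    A^T = A -> i != j -> A i i = 0 -> A j j = 0 ->
  smallest_eigenvalue A <= - A i j /\ A i j <= largest_eigenvalue A.
Proof.
move=> symA neq_ij Aii Ajj; have n0 : (0 < n)%N.
  by apply: leq_ltn_trans (ltn_ord i).
have [_ leA] := smallest_eigenvalueP n0 symA.
have [_ geA] := largest_eigenvalueP n0 symA.
have Aji : A j i = A i j by rewrite -{1}symA mxE.
pose u : 'rV[R]_n := delta_mx 0 i; pose v : 'rV[R]_n := delta_mx 0 j.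
have dot_delta (k l : 'I_n) :
    dot (delta_mx 0 k) (delta_mx 0 l) = (k == l)%:R :> R.
  by rewrite -[X in dot X _]mulmx1 dot_delta_mulmx mxE.
have /= := leA (u - v); have /= := geA (u + v).
rewrite mulmxDl mulmxBl !(dotDl, dotDr, dotNl, dotNr) !dot_delta_mulmx.
rewrite Aii Ajj Aji !dot_delta !eqxx (negPf neq_ij) eq_sym (negPf neq_ij).
by rewrite /= mulr0n mulr1n => geA_uv leA_uv; split; lra.
Qed.

End Rayleigh.

(** * Hoffman's bound *)

Section Hoffman.
Context {R : realType}.

(** Each [x - c x_j], with [x_j] the restriction of [x] to color [j], is [x] with
    the class of [j] multiplied by [1 - c].  The factor [c] is the one that
    minimizes the resulting bound: with [x - s x_j] one gets
    [l (c - 2 s) >= m (c - 2 s + s^2)], whose sharpest form is at [s = c]. *)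
Lemma Hoffman_bound n c (A : 'M[R]_n) (f : 'I_n -> 'I_c) (m l : R) :
    A^T = A -> (forall i j, f i = f j -> A i j = 0) ->
    (forall x, m * dot x x <= dot (x *m A) x) -> eigenvalue A l ->
  l + (c%:R - 1) * m <= 0.
Proof.
move=> symA colA leA /eigenvalueP[x xA x0].
pose z j : 'rV[R]_n := \row_i (if f i == j then x 0 i else 0).
have sum_z : \sum_j z j = x.
  apply/rowP => i; rewrite summxE (bigD1 (f i)) //= mxE eqxx big1 ?addr0 //.
  by move=> j; rewrite mxE eq_sym => /negPf->.
have dot_zz j : dot (z j) (z j) = dot x (z j).
  rewrite !dotE; apply: eq_bigr => i _; rewrite mxE.
  by case: eqP => // _; rewrite !mulr0.
have dot_zA j : dot (z j *m A) (z j) = 0.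
  rewrite dotE big1 // => i _; rewrite mxE mulr_suml big1 // => i' _.
  rewrite !mxE; case: eqP => [fi'|]; last by rewrite !mul0r.
  case: eqP => [fi|]; last by rewrite mulr0.
  by rewrite colA ?fi // mulr0 mul0r.
pose C : R := c%:R.
have step j : m * (dot x x - 2 * C * dot x (z j) + C ^+ 2 * dot x (z j))
    <= l * (dot x x - 2 * C * dot x (z j)).
  have := leA (x - C *: z j).
  rewrite mulmxBl -scalemxAl !(dotDl, dotDr, dotNl, dotNr, dotZl, dotZr).
  rewrite (dot_mulmxC (z j) x symA) dot_zA dot_zz (dotC (z j) x) xA !dotZl.
  set p := dot x x; set q := dot x (z j); lra.
have := ler_sum (index_enum 'I_c) (P := predT) (fun j _ => step j).
rewrite -!mulr_sumr !big_split /= !sumrN -!mulr_sumr.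
rewrite !sumr_const card_ord -[dot x x *+ c]mulr_natl -/C.
rewrite -!dot_sumr sum_z.
have X0 : 0 < dot x x by rewrite dot_gt0.
(* Without colors there are no indices, hence no nonzero vector. *)
have C0 : 0 < C.
  rewrite ltr0n; case: c f {z C sum_z dot_zz dot_zA step colA} => // f.
  suff n0 : x = 0 by rewrite n0 eqxx in x0.
  by apply/rowP => i; case: (f i).
move=> sum_le; rewrite -(pmulr_rle0 _ (mulr_gt0 C0 X0)); nra.
Qed.

End Hoffman.

(** * Colorings and chromatic numbers *)

Section Colorings.
Context {V : finType}.
Implicit Types H : hypergraph V.

(** In a loopless hypergraph each edge, being nonempty, has two distinct
    vertices. *)
Lemma strong_proper_coloring H (C : finType) (f : {ffun V -> C}) :
  loopless H -> strong_coloring H f -> proper_coloring H f.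
Proof.
move=> noloop /forall_inP strong; apply/forall_inP => e eH.
have e0 : e != set0.
  by apply: contraTneq eH => ->; rewrite inE edge_nonempty.
have : (1 < #|e|)%N by rewrite ltn_neqAle eq_sym noloop // card_gt0.
case/card_gt1P => u [v [ue ve uv]].
apply/exists_inP; exists u => //; apply/exists_inP; exists v => //.
by have /forall_inP/(_ u ue)/forall_inP/(_ v ve)/implyP/(_ uv) := strong e eH.
Qed.

Lemma injective_strong_coloring H (C : finType) (f : {ffun V -> C}) :
  injective f -> strong_coloring H f.
Proof.
move=> injf; apply/forall_inP => e _; apply/forall_inP => u _.
by apply/forall_inP => v _; rewrite (inj_eq injf) implybb.
Qed.

Lemma enum_rank_strong_coloring H :
  strong_coloring H [ffun v : V => enum_rank v].
Proof.
by apply: injective_strong_coloring => u v; rewrite !ffunE => /enum_rank_inj.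
Qed.

Lemma strong_chromatic_coloring H :
  exists f : {ffun V -> 'I_(strong_chromatic_number H)}, strong_coloring H f.
Proof.
rewrite /strong_chromatic_number; case: arg_minnP => [|c /existsP[f fP] _].
  by apply/existsP; exists [ffun v : V => enum_rank v];
    apply: enum_rank_strong_coloring.
by exists f.
Qed.

(** The minimum defining the chromatic number ranges over [c <= #|V|] and falls
    back on [#|V|]; looplessness makes this fallback value admissible, as a
    coloring by distinct colors is then proper. *)
Lemma chromatic_numberP H : loopless H ->
  (exists f : {ffun V -> 'I_(chromatic_number H)}, proper_coloring H f) /\
  forall c (f : {ffun V -> 'I_c}), proper_coloring H f ->
    (chromatic_number H <= c)%N.
Proof.
move=> noloop.
rewrite /chromatic_number; case: arg_minnP => [|c /existsP[f fP] minc].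
  apply/existsP; exists [ffun v : V => enum_rank v].
  exact/strong_proper_coloring/enum_rank_strong_coloring.
split=> [|d g gP]; first by exists f.
have [leVd|ltdV] := ltnP #|V| d.
  by apply: leq_trans (ltnW leVd); rewrite -ltnS.
by apply: (minc (Ordinal (ltdV : (d < #|V|.+1)%N))); apply/existsP; exists g.
Qed.

Lemma chromatic_number_le_strong H : loopless H ->
  (chromatic_number H <= strong_chromatic_number H)%N.
Proof.
move=> noloop; have [f fP] := strong_chromatic_coloring H.
by have [_ /(_ _ f)] := chromatic_numberP noloop; apply;
  apply: strong_proper_coloring.
Qed.

Lemma edges_spanning H e :
  (e \in edges (spanning_subgraph H)) = (e \in edges H) && (#|e| == 2%N).
Proof.
by rewrite !inE /= ffunE; case: ifP; rewrite ?andbT ?andbF ?ltnn.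
Qed.

Lemma loopless_spanning H : loopless (spanning_subgraph H).
Proof. by move=> e; rewrite edges_spanning => /andP[_ /eqP->]. Qed.

Lemma chromatic_number_spanning H : loopless H ->
  (chromatic_number (spanning_subgraph H) <= chromatic_number H)%N.
Proof.
move=> noloop; have [[f /forall_inP fP] _] := chromatic_numberP noloop.
have [_ /(_ _ f)] := chromatic_numberP (@loopless_spanning H); apply.
apply/forall_inP => e; rewrite edges_spanning => /andP[eH _]; exact: fP.
Qed.

End Colorings.

(** * Adjacency and unified matrices *)

Section Matrices.
Context {R : realType} {V : finType}.
Implicit Types H : hypergraph V.

Lemma adjacency_matrix_sym H : (adjacency_matrix H R)^T = adjacency_matrix H R.
Proof. by apply/matrixP => i j; rewrite !mxE setUC. Qed.

Lemma unified_matrix_sym H : (unified_matrix H R)^T = unified_matrix H R.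
Proof.
apply/matrixP => i j; rewrite !mxE. congr (nat_of_bool _)%:R.
apply: eq_existsb => e; congr (_ && _).
by rewrite /two_partition andbCA disjoint_sym setUC.
Qed.

Lemma two_partition_set1 e (u v : V) :
  two_partition e [set u] [set v] = (u != v) && ([set u; v] == e).
Proof.
rewrite /two_partition -!card_gt0 !cards1 /=.
by rewrite disjoints_subset sub1set !inE.
Qed.

Lemma set1_in_part_index H (v : V) : [set v] \in part_index H.
Proof. by rewrite inE imset_f ?orbT. Qed.

(** The position of a singleton among the parts.  The vertex [v0] only witnesses
    that there is a part, as the enumeration of a finite set requires. *)
Definition vertex_index H (v0 : V) (i : 'I_#|V|) : 'I_(e_index H) :=
  enum_rank_in (set1_in_part_index H v0) [set enum_val i].

Lemma vertex_indexK H v0 i : enum_val (vertex_index H v0 i) = [set enum_val i].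
Proof. by rewrite enum_rankK_in // set1_in_part_index. Qed.

Lemma vertex_index_inj H v0 : injective (vertex_index H v0).
Proof.
by move=> i j /(congr1 enum_val); rewrite !vertex_indexK =>
  /set1_inj/enum_val_inj.
Qed.

(** A 2-partition into singletons [{u}], [{v}] is one of the edge [{u, v}] with
    [u] and [v] distinct, which is an edge of cardinality two. *)
Lemma unified_matrix_singletons H v0 :
  mxsub (vertex_index H v0) (vertex_index H v0) (unified_matrix H R)
  = adjacency_matrix (spanning_subgraph H) R.
Proof.
apply/matrixP => i j; rewrite !mxE !vertex_indexK edges_spanning cards2.
congr (nat_of_bool _)%:R.
apply/exists_inP/andP => [[e eH]|[eH uv]].
  by rewrite two_partition_set1 => /andP[-> /eqP->].
exists [set enum_val i; enum_val j] => //.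
by rewrite two_partition_set1 eqxx andbT; case: (_ != _) uv.
Qed.

Lemma adjacency_extreme_eigenvalues H e : e \in edges H -> #|e| = 2%N ->
    loopless H ->
  smallest_eigenvalue (adjacency_matrix H R) <= -1 /\
  1 <= largest_eigenvalue (adjacency_matrix H R).
Proof.
move=> eH /eqP/cards2P[u [v [uv e_uv]]] noloop.
have Aii i : adjacency_matrix H R i i = 0.
  by rewrite mxE setUid; case: (boolP (_ \in _)) => // /noloop; rewrite cards1.
have := extreme_eigenvalues_entry (adjacency_matrix_sym H)
  (i := enum_rank u) (j := enum_rank v) _ (Aii _) (Aii _).
by rewrite (inj_eq enum_rank_inj) mxE !enum_rankK -e_uv eH; apply.
Qed.

Lemma adjacency_monochromatic H c (f : {ffun V -> 'I_c}) :
    proper_coloring H f ->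
  forall i j, f (enum_val i) = f (enum_val j) -> adjacency_matrix H R i j = 0.
Proof.
move=> /forall_inP fP i j fij; rewrite mxE.
case: (boolP (_ \in _)) => // /fP.
by case/exists_inP => u /set2P[]-> /exists_inP[v /set2P[]->];
  rewrite ?fij eqxx.
Qed.

Lemma Hoffman_chromatic_bound H e : loopless H -> e \in edges H -> #|e| = 2%N ->
  1 + largest_eigenvalue (adjacency_matrix H R)
      / `|smallest_eigenvalue (adjacency_matrix H R)|
  <= (chromatic_number H)%:R.
Proof.
move=> noloop eH e2.
have [small_lt0 _] := adjacency_extreme_eigenvalues eH e2 noloop.
have symA := adjacency_matrix_sym H; have V0 := vertex_nonempty H.
have [_ leA] := smallest_eigenvalueP V0 symA.
have [eigA _] := largest_eigenvalueP V0 symA.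
have [[f /adjacency_monochromatic fP] _] := chromatic_numberP noloop.
have := Hoffman_bound symA (f := fun i => f (enum_val i)) fP leA eigA.
set l := largest_eigenvalue _; set m := smallest_eigenvalue _ in small_lt0 *.
move=> bound; have m0 : m < 0 by lra.
rewrite -lerBrDl ltr0_norm // ler_pdivrMr ?oppr_gt0 //; lra.
Qed.

Lemma smallest_unified_le_adjacency H :
  smallest_eigenvalue (unified_matrix H R)
  <= smallest_eigenvalue (adjacency_matrix (spanning_subgraph H) R).
Proof.
have /card_gt0P[v0 _] := vertex_nonempty H.
rewrite -(unified_matrix_singletons H v0).
apply: smallest_eigenvalue_mxsub (vertex_nonempty H) _ (@vertex_index_inj H v0)
  (unified_matrix_sym H).
by apply/card_gt0P; exists [set v0]; apply: set1_in_part_index.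
Qed.

End Matrices.

Theorem theorem9p7 (R : realType) (V : finType) (H : hypergraph V)
    (Hsimple : simple H) (Hedge2 : exists2 e, e \in edges H & #|e| = 2%N) :
  let G := spanning_subgraph H in
  let lambda1_G := largest_eigenvalue (adjacency_matrix G R) in
  let lambdan_G := smallest_eigenvalue (adjacency_matrix G R) in
  let lambdak_H := smallest_eigenvalue (unified_matrix H R) in
  [/\ (chromatic_number H <= strong_chromatic_number H)%N,
      (chromatic_number G <= chromatic_number H)%N,
      1 + lambda1_G / `|lambdan_G| <= (chromatic_number G)%:R
    & 1 + lambda1_G / `|lambdak_H| <= 1 + lambda1_G / `|lambdan_G| ].
Proof.
move=> G lambda1_G lambdan_G lambdak_H.
have [noloop _] := Hsimple; have [e eH e2] := Hedge2.
have noloopG : loopless G := @loopless_spanning _ H.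
have eG : e \in edges G by rewrite edges_spanning eH e2.
split; first exact: chromatic_number_le_strong.
- exact: chromatic_number_spanning.
- exact: Hoffman_chromatic_bound eG e2.
have := smallest_unified_le_adjacency (R := R) H.
have := adjacency_extreme_eigenvalues (R := R) eG e2 noloopG.
rewrite -/G -/lambda1_G -/lambdan_G -/lambdak_H => -[n_lt0 l1_gt0] le_kn.
have n0 : lambdan_G < 0 by lra.
have k0 : lambdak_H < 0 by lra.
rewrite lerD2l ler_wpM2l //; first lra.
by rewrite !ltr0_norm // lef_pV2 ?posrE ?oppr_gt0 // lerN2.
Qed.
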